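(* Let $d\ge1$, $\mu\in\mathbb{R}^d$, $A$ a $d\times d$ symmetric positive definite matrix and $R$ a $d\times d$ reflection nonsingular $\mathcal{M}$-matrix. Fix a nonempty subset $I\subseteq\{1,\dots,d\}$. If $\mathrm{SRBM}^{|I|}([R]_I,[\mu]_I,[A]_I)$ hits the corner, then $\mathrm{SRBM}^d(R,\mu,A)$ hits the edge $S_I$.
   Context: For $I=\{i_1<\dots<i_m\}$: $[x]_I=(x_{i_1},\dots,x_{i_m})'$, $[C]_I=(c_{i_ki_l})_{k,l}$. $S=\mathbb{R}^d_+$, $S_I=\{x\in S:x_i=0\ \forall i\in I\}$. Reflection nonsingular $\mathcal{M}$-matrix: $r_{ii}=1$, $r_{ij}\le0$ ($i\ne j$), spectral radius of $I_d-R$ less than $1$. $\mathrm{SRBM}^d(R,\mu,A)$ started at $z\in S$: continuous adapted $S$-valued $Z=B+RL$, with $B$ a Brownian motion with drift $\mu$, covariance $A$, $B(0)=z$, and $L=(L_1,\dots,L_d)'$ continuous adapted, each $L_k$ nondecreasing, $L_k(0)=0$, $\int_0^\infty Z_k\,dL_k=0$ (exists and pathwise unique for all $z$). It hits $S_I$ if $\mathbb{P}_z(\exists t>0: Z(t)\in S_I)>0$ for every $z\in S$; hitting the corner means hitting $\{0\}$. *)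

(* Defs.v *)
From HB Require Import structures.
From mathcomp Require Import all_boot all_order all_algebra.
From mathcomp Require Import all_classical all_reals all_analysis.
From mathcomp Require Import complex.
Set Implicit Arguments.
Unset Strict Implicit.
Unset Printing Implicit Defensive.
Import Order.TTheory GRing.Theory Num.Theory.
Import numFieldNormedType.Exports.
Local Open Scope classical_set_scope.
Local Open Scope ring_scope.

Section SRBM.
Variable R : realType.

(** [x]_I and [C]_I, for I = {i_1 < ... < i_m} (enum of a subset of 'I_d is increasing). *)
Definition subvec d (I : {set 'I_d}) (x : 'cV[R]_d) : 'cV[R]_#|I| :=
  \col_(k < #|I|) x (enum_val k) 0.
Definition submat d (I : {set 'I_d}) (C : 'M[R]_d) : 'M[R]_#|I| :=
  \matrix_(k < #|I|, l < #|I|) C (enum_val k) (enum_val l).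

Definition orthant d : set 'cV[R]_d := [set x | forall i, 0 <= x i 0].
Definition face d (I : {set 'I_d}) : set 'cV[R]_d :=
  [set x | orthant x /\ forall i, i \in I -> x i 0 = 0].
Definition corner d : set 'cV[R]_d := [set 0].

Definition sym_posdef d (A : 'M[R]_d) :=
  A^T = A /\ forall u : 'cV[R]_d, u != 0 -> 0 < (u^T *m A *m u) 0 0.

Definition spectral_radius_lt1 d (M : 'M[R]_d) :=
  forall z : R[i], root (char_poly (map_mx (fun x : R => x%:C%C) M)) z -> `|z| < 1.

Definition reflection_Mmatrix d (Rm : 'M[R]_d) :=
  (forall i, Rm i i = 1) /\ (forall i j, i != j -> Rm i j <= 0) /\
  spectral_radius_lt1 (1%:M - Rm).

Definition gauss_law (m v : R) (V : set R) : \bar R :=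
  if v == 0 then (if `[< V m >] then 1%E else 0%E)
  else normal_prob m (Num.sqrt v) V.

Section Process.
Context {dO : measure_display} {Omega : measurableType dO}.
Variable P : probability Omega R.

Definition is_filtration (F : R -> set (set Omega)) :=
  (forall t, 0 <= t -> sigma_algebra setT (F t)) /\
  (forall t, 0 <= t -> F t `<=` measurable) /\
  (forall s t, 0 <= s -> s <= t -> F s `<=` F t).

Definition adapted d (F : R -> set (set Omega)) (X : R -> Omega -> 'cV[R]_d) :=
  forall t, 0 <= t -> forall i (V : set R), measurable V ->
    F t [set w | X t w i 0 \in V].

Definition cont_paths d (X : R -> Omega -> 'cV[R]_d) :=
  forall w, {within `[0, +oo[, continuous (fun t => X t w)}.

(** B is an (F_t)-Brownian motion with drift mu, covariance A, B(0) = z: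
    continuous adapted paths, B(0) = z, and for 0 <= s <= t the increment
    B t - B s is independent of F s and Gaussian N((t-s) mu, (t-s) A)
    (Gaussian vectors via the Cramer-Wold definition: every linear form is
    Gaussian; independence tested on product Borel sets, a generating pi-system). *)
Definition is_BM d (F : R -> set (set Omega)) (mu : 'cV[R]_d) (A : 'M[R]_d)
    (z : 'cV[R]_d) (B : R -> Omega -> 'cV[R]_d) :=
  cont_paths B /\ adapted F B /\ (forall w, B 0 w = z) /\
  (forall s t, 0 <= s -> s <= t ->
     (forall (u : 'cV[R]_d) (V : set R), measurable V ->
        P [set w | ((u^T *m (B t w - B s w)) 0 0) \in V] =
        gauss_law ((t - s) * (u^T *m mu) 0 0) ((t - s) * (u^T *m A *m u) 0 0) V) /\
     (forall (E : set Omega) (U : 'I_d -> set R),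
        F s E -> (forall i, measurable (U i)) ->
        P (E `&` [set w | forall i, ((B t w - B s w) i 0)%R \in U i]) =
        (P E * P [set w | forall i, ((B t w - B s w) i 0)%R \in U i])%E)).

(** \int_0^oo f dg = 0, for g nondecreasing and continuous on [0, oo):
    Lebesgue-Stieltjes integral w.r.t. the cumulative function t |-> g (max t 0). *)
Definition stieltjes_zero (f g : R -> R) :=
  forall c : cumulative R R, (c : R -> R) = (fun t => g (Num.max t 0)) ->
    (\int[lebesgue_stieltjes_measure c]_(t in (`[0%R, +oo[%classic : set R)) (f t)%:E)%E = 0%E.

Definition is_SRBM d (Rm : 'M[R]_d) (mu : 'cV[R]_d) (A : 'M[R]_d) (z : 'cV[R]_d)
    (F : R -> set (set Omega)) (B L Z : R -> Omega -> 'cV[R]_d) :=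
  is_filtration F /\ is_BM F mu A z B /\
  cont_paths Z /\ adapted F Z /\ (forall t w, 0 <= t -> orthant (Z t w)) /\
  cont_paths L /\ adapted F L /\
  (forall t w, 0 <= t -> Z t w = B t w + Rm *m L t w) /\
  (forall w k, L 0 w k 0 = 0) /\
  (forall w k s t, 0 <= s -> s <= t -> L s w k 0 <= L t w k 0) /\
  (forall w k, stieltjes_zero (fun t => Z t w k 0) (fun t => L t w k 0)).

End Process.

Definition SRBM_hits d (Rm : 'M[R]_d) (mu : 'cV[R]_d) (A : 'M[R]_d)
    (E : set 'cV[R]_d) :=
  forall z, orthant z ->
  forall (dO : measure_display) (Omega : measurableType dO)
    (P : probability Omega R) (F : R -> set (set Omega))
    (B L Z : R -> Omega -> 'cV[R]_d),
    is_SRBM P Rm mu A z F B L Z ->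
    (0 < P [set w | exists t : R, (0 < t)%R /\ E (Z t w)])%E.

End SRBM.

(* Main.v *)
(** The coordinates of [Z] in [I] satisfy the Skorokhod equation of the reduced
    process driven by [B]_I, perturbed by the terms [R_ij L_j] with [i] in [I] and
    [j] outside [I], which are nonincreasing because [R_ij <= 0]. The regulator of
    the reduced equation is the increasing limit of the Picard iterates started
    at 0; these stay below [L]_I, in value and in increments, so the limit exists,
    is continuous and adapted, and yields a reduced SRBM on the same probability
    space. One-dimensional comparison gives [Z]_I <= reduced SRBM, so [Z] lies in
    [S_I] whenever the reduced process is at the corner. *)
Require Import Defs.
From HB Require Import structures.
From mathcomp Require Import all_boot all_order all_algebra.
From mathcomp Require Import all_classical all_reals all_analysis.
From mathcomp Require Import complex.
From mathcomp Require Import measurable_realfun ring lra.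
Import Order.TTheory GRing.Theory Num.Theory.
Local Open Scope classical_set_scope.
Local Open Scope ring_scope.

Set Implicit Arguments.
Unset Strict Implicit.
Unset Printing Implicit Defensive.
Import numFieldNormedType.Exports.

(** * Running suprema floored at 0, and their comparison *)

Section RunningSup.
Variable R : realType.
Implicit Types (x y X Y c : R -> R).

(** The one-dimensional Skorokhod regulator, with [y] minus the free path. Being a relation, it can
    be asserted of a regulator that is given rather than computed. *)
Definition is_running_sup y Y := forall t, 0 <= t ->
  [/\ 0 <= Y t, forall s, 0 <= s <= t -> y s <= Y t &
      forall u, 0 <= u -> (forall s, 0 <= s <= t -> y s <= u) -> Y t <= u].

Definition running_sup y t := sup [set Num.max 0 (y s) | s in `[0, t]%classic].

(** The bound [X] makes the set under [sup] bounded above; without a bound, [sup] is a default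
    value. *)
Lemma running_supP y X : (forall s t, 0 <= s <= t -> y s <= X t) ->
  is_running_sup y (running_sup y).
Proof.
move=> yX t t0; pose A := [set Num.max 0 (y s) | s in `[0, t]%classic].
have A0 : A (Num.max 0 (y 0)) by exists 0 => //=; rewrite in_itv/= lexx.
have supA : has_sup A.
  split; first by exists (Num.max 0 (y 0)).
  exists (Num.max 0 (X t)) => _ [s /= + <-]; rewrite in_itv/= => st.
  by rewrite ge_max le_max lexx/= le_max yX// orbT.
have ubA := ub_le_sup (proj2 supA).
split.
- by rewrite /running_sup -/A; apply: le_trans (ubA _ A0); rewrite le_max lexx.
- move=> s st; rewrite /running_sup -/A.
  apply: le_trans (ubA (Num.max 0 (y s)) _); first by rewrite le_max lexx orbT.
  by exists s => //=; rewrite in_itv/=.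
- move=> u u0 yu; apply: ge_sup; first by exists (Num.max 0 (y 0)).
  by move=> _ [s /= + <-]; rewrite in_itv/= => /yu ysu; rewrite ge_max u0.
Qed.

Lemma eq_is_running_sup x y Y : (forall s, 0 <= s -> x s = y s) ->
  is_running_sup x Y -> is_running_sup y Y.
Proof.
move=> xy xY t t0; have [Y0 xYt Yle] := xY t t0; split=> // [s st|u u0 yu].
  by rewrite -xy ?xYt//; case/andP: st.
by apply: Yle => // s st; rewrite xy ?yu//; case/andP: st.
Qed.

Lemma is_running_sup_homo y Y : is_running_sup y Y ->
  forall s t, 0 <= s -> s <= t -> Y s <= Y t.
Proof.
move=> yY s t s0 st; have t0 := le_trans s0 st.
have [Yt0 yYt _] := yY t t0; have [_ _] := yY s s0; apply=> // r /andP[r0 rs].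
by apply: yYt; rewrite r0 (le_trans rs).
Qed.

Lemma le_is_running_sup x X y Y : is_running_sup x X -> is_running_sup y Y ->
  (forall s, 0 <= s -> y s <= x s) -> forall t, 0 <= t -> Y t <= X t.
Proof.
move=> xX yY yx t t0; have [X0 xXt _] := xX t t0; have [_ _] := yY t t0.
by apply=> // s st; apply: le_trans (xXt _ st); apply: yx; case/andP: st.
Qed.

(** As [x - y] is nondecreasing, [x s = y s + (x s - y s)] stays below [Y t + (x t - y t)] on
    [[0, t]]. Rearranged, [X - x <= Y - y]: the larger pull gives the lower reflected path. *)
Lemma is_running_sup_gap x X y Y :
  is_running_sup x X -> is_running_sup y Y ->
  (forall s, 0 <= s -> y s <= x s) ->
  (forall s t, 0 <= s -> s <= t -> x s - y s <= x t - y t) ->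
  forall t, 0 <= t -> X t - Y t <= x t - y t.
Proof.
move=> xX yY yx xy_nd t t0.
have [Y0 yYt _] := yY t t0; have [_ _ Xle] := xX t t0.
suff : X t <= Y t + (x t - y t) by lra.
apply: Xle => [|s st]; first by have := yx t t0; lra.
have /andP[s0 st'] := st.
by have := xy_nd s t s0 st'; have := yYt s st; lra.
Qed.

(** Up to time [s], [y] stays below [Y s]. At a later [r <= t], monotonicity of [x - y] and the gap
    bound at [s] give [y r <= x r - (x s - y s) <= X t - (X s - Y s)]. *)
Lemma is_running_sup_gap_homo x X y Y :
  is_running_sup x X -> is_running_sup y Y ->
  (forall s, 0 <= s -> y s <= x s) ->
  (forall s t, 0 <= s -> s <= t -> x s - y s <= x t - y t) ->
  forall s t, 0 <= s -> s <= t -> X s - Y s <= X t - Y t.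
Proof.
move=> xX yY yx xy_nd s t s0 st; have t0 := le_trans s0 st.
have [Ys0 yYs _] := yY s s0; have [_ _ Yle] := yY t t0.
have [_ xXt _] := xX t t0.
have Xst := is_running_sup_homo xX s0 st.
suff : Y t <= Y s + (X t - X s) by lra.
apply: Yle => [|r rt]; first lra.
have /andP[r0 rt'] := rt.
have [rs|sr] := leP r s.
  by have := yYs r; rewrite r0 rs => /(_ isT); lra.
have := is_running_sup_gap xX yY yx xy_nd s0.
have := xy_nd s r s0 (ltW sr); have := xXt r rt; lra.
Qed.

End RunningSup.

(** * The minimal regulator by monotone iteration *)

(* [L] is the regulator of the driving path [b] for the reflection matrix
   [1 - Q] iff each [L k] is the running supremum of [pull L k], the reflected
   path being [L k - pull L k]. [M] solves the same equation with an additional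
   nondecreasing push [W]. Iterating from 0 stays below [M], also for increments:
   the limit inherits the continuity of [M]. *)
Section MinimalRegulator.
Variables (R : realType) (m : nat) (Q : 'M[R]_m) (b : 'I_m -> R -> R).

Definition pull (L : 'I_m -> R -> R) k t := \sum_l Q k l * L l t - b k t.

Fixpoint reg_iter n : 'I_m -> R -> R := if n is n'.+1
  then fun k => running_sup (pull (reg_iter n') k) else fun _ _ => 0.

Definition reg_lim k t := limn (fun n => reg_iter n k t).

Variables (M W : 'I_m -> R -> R).
Hypothesis Q0 : forall k l, 0 <= Q k l.
Hypothesis M0 : forall k, M k 0 = 0.
Hypothesis W0 : forall k, W k 0 = 0.
Hypothesis W_nd : forall k s t, 0 <= s -> s <= t -> W k s <= W k t.
Hypothesis M_sup : forall k,
  is_running_sup (fun t => pull M k t + W k t) (M k).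

(** The invariant of the iteration. Since [Q] is nonnegative and [W] nondecreasing from 0,
    domination in value puts [pull L] below [pull M + W], and domination of increments makes the
    difference nondecreasing: these are the hypotheses of the gap lemmas, which return the invariant
    for the next iterate. *)
Let dominated (L : 'I_m -> R -> R) :=
  (forall k s t, 0 <= s -> s <= t -> L k t - L k s <= M k t - M k s) /\
  (forall k s, 0 <= s -> L k s <= M k s).

Let W_ge0 k t : 0 <= t -> 0 <= W k t.
Proof. by move=> t0; rewrite -(W0 k) W_nd. Qed.

Let pull_le L L' k t : (forall l, L l t <= L' l t) -> pull L k t <= pull L' k t.
Proof. by move=> LL'; rewrite lerB// ler_sum// => l _; rewrite ler_wpM2l. Qed.

Let dom_pull_le L : dominated L ->
  forall k t, 0 <= t -> pull L k t <= pull M k t + W k t.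
Proof.
move=> [_ LM] k t t0; have := W_ge0 k t0.
by have := @pull_le L M k t (fun l => LM l t t0); lra.
Qed.

Let dom_pull_gap L : dominated L -> forall k s t, 0 <= s -> s <= t ->
  pull M k s + W k s - pull L k s <= pull M k t + W k t - pull L k t.
Proof.
move=> [LM _] k s t s0 st; have := W_nd k s0 st; rewrite /pull.
have : \sum_l Q k l * L l t - \sum_l Q k l * L l s <=
       \sum_l Q k l * M l t - \sum_l Q k l * M l s.
  rewrite -!sumrB ler_sum// => l _; rewrite -!mulrBr ler_wpM2l//.
  exact: LM.
lra.
Qed.

Let dom_step L : dominated L ->
  (forall k, is_running_sup (pull L k) (running_sup (pull L k))) /\
  dominated (fun k => running_sup (pull L k)).
Proof.
move=> domL; have sup_pull k : is_running_sup (pull L k) (running_sup (pull L k)).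
  apply: (@running_supP _ _ (M k)) => s t /andP[s0 st].
  apply: le_trans (dom_pull_le domL k s0) _.
  by have [_ + _] := M_sup k (le_trans s0 st); apply; rewrite s0.
split => //; split => [k s t s0 st|k s s0].
- have := is_running_sup_gap_homo (M_sup k) (sup_pull k)
    (dom_pull_le domL k) (dom_pull_gap domL k) s0 st; lra.
- exact: le_is_running_sup (M_sup k) (sup_pull k) (dom_pull_le domL k) _ s0.
Qed.

Let reg_iter_dom n : dominated (reg_iter n).
Proof.
elim: n => [|n IHn] /=; last exact: (dom_step IHn).2.
split=> [k s t s0 st|k s s0].
  by have := is_running_sup_homo (M_sup k) s0 st; lra.
by have [] := M_sup k s0.
Qed.

Lemma reg_iterP n k : is_running_sup (pull (reg_iter n) k) (reg_iter n.+1 k).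
Proof. exact: (dom_step (reg_iter_dom n)).1. Qed.

Lemma reg_iter_ge0 n k t : 0 <= t -> 0 <= reg_iter n k t.
Proof. by case: n => [|n] // t0; have [] := reg_iterP n k t0. Qed.

Lemma reg_iter_homo n k s t : 0 <= s -> s <= t -> reg_iter n k s <= reg_iter n k t.
Proof.
by case: n => [|n] // s0 st; apply: is_running_sup_homo (reg_iterP n k) _ _ s0 st.
Qed.

Lemma reg_iter_incr n k s t : 0 <= s -> s <= t ->
  reg_iter n k t - reg_iter n k s <= M k t - M k s.
Proof. exact: (reg_iter_dom n).1. Qed.

(** The iteration starts at 0, below every later iterate, and [pull] is monotone in the regulator
    because [Q] is nonnegative. *)
Lemma reg_iter_le_succ n k t : 0 <= t -> reg_iter n k t <= reg_iter n.+1 k t.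
Proof.
elim: n k t => [|n IHn] k t t0; first by rewrite [leLHS]/=; apply: reg_iter_ge0.
apply: le_is_running_sup (reg_iterP n.+1 k) (reg_iterP n k) _ _ t0 => s s0.
by apply: pull_le => l; apply: IHn.
Qed.

Lemma reg_iter_cvg k t : 0 <= t -> (fun n => reg_iter n k t) @ \oo --> reg_lim k t.
Proof.
move=> t0; apply: nondecreasing_is_cvgn.
  by apply/nondecreasing_seqP => n; apply: reg_iter_le_succ.
by exists (M k t) => _ [n _ <-]; apply: (reg_iter_dom n).2.
Qed.

Lemma reg_iter_le_lim n k t : 0 <= t -> reg_iter n k t <= reg_lim k t.
Proof.
move=> t0; apply: nondecreasing_cvgn_le; last exact: reg_iter_cvg.
by apply/nondecreasing_seqP => j; apply: reg_iter_le_succ.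
Qed.

Lemma reg_lim_le k t u : 0 <= t -> (forall n, reg_iter n k t <= u) -> reg_lim k t <= u.
Proof.
move=> t0 h; rewrite /reg_lim; apply: limr_le; first exact: reg_iter_cvg.
by apply: nearW.
Qed.

Let reg_lim_dom : dominated reg_lim.
Proof.
split=> [k s t s0 st|k s s0]; last by apply: reg_lim_le => // n; apply: (reg_iter_dom n).2.
have t0 := le_trans s0 st.
suff : reg_lim k t <= reg_lim k s + (M k t - M k s) by lra.
apply: reg_lim_le => // n; have := reg_iter_incr n k s0 st.
by have := reg_iter_le_lim n k s0; lra.
Qed.

Lemma reg_lim_incr k s t : 0 <= s -> s <= t ->
  reg_lim k t - reg_lim k s <= M k t - M k s.
Proof. exact: reg_lim_dom.1. Qed.

(** Two suprema, over time and over [n], are exchanged. Upper bound: [pull (reg_iter n) <= reg_iter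
    n.+1 <= reg_lim], then [n] tends to infinity at a fixed time. Minimality: a bound on the
    limiting pull bounds the pull of each iterate. *)
Lemma reg_limP k : is_running_sup (pull reg_lim k) (reg_lim k).
Proof.
move=> t t0; split.
- exact: le_trans (reg_iter_ge0 0 k t0) (reg_iter_le_lim _ _ t0).
- move=> s st; have /andP[s0 _] := st.
  have pcvg : (fun n => pull (reg_iter n) k s) @ \oo --> pull reg_lim k s.
    apply: cvgB; last exact: cvg_cst.
    apply: cvg_big => [|l _]; first exact: add_continuous.
    by apply: cvgM; [exact: cvg_cst|exact: reg_iter_cvg].
  rewrite -(cvg_lim _ pcvg)//; apply: limr_le; first exact: cvgP pcvg.
  apply: nearW => n; apply: le_trans (reg_iter_le_lim n.+1 k t0).
  by have [_ + _] := reg_iterP n k t0; apply.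
- move=> u u0 yu; apply: reg_lim_le => // -[|n] //.
  have [_ _] := reg_iterP n k t0; apply=> // s st; apply: le_trans (yu s st).
  by apply: pull_le => l; apply: reg_iter_le_lim; case/andP: st.
Qed.

Lemma reg_lim0 k : reg_lim k 0 = 0.
Proof.
apply/eqP; rewrite eq_le; apply/andP; split.
  by rewrite -[leRHS](M0 k); apply: reg_lim_dom.2.
by have [] := reg_limP k (lexx 0).
Qed.

Lemma reg_lim_gap k t : 0 <= t ->
  M k t - reg_lim k t <= pull M k t + W k t - pull reg_lim k t.
Proof.
exact: is_running_sup_gap (M_sup k) (reg_limP k) (dom_pull_le reg_lim_dom k)
  (dom_pull_gap reg_lim_dom k) _.
Qed.

End MinimalRegulator.

(** * Half-line paths and the complementarity condition *)

Section Paths.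
Variable R : realType.

(* Paths on [0, +oo[ are frozen at time 0 on the negative side, so that
   continuity becomes continuity on the whole line. *)
Definition clip (t : R) := Num.max t 0.

Lemma clip_ge0 t : 0 <= clip t.
Proof. by rewrite /clip le_max lexx orbT. Qed.

Lemma clipE t : 0 <= t -> clip t = t.
Proof. by move=> t0; rewrite /clip max_l. Qed.

Lemma clip_homo s t : s <= t -> clip s <= clip t.
Proof. by move=> st; rewrite /clip ge_max !le_max st lexx !orbT. Qed.

Lemma continuous_clip : continuous clip.
Proof. by move=> t; apply: continuous_max; [exact: cvg_id|exact: cvg_cst]. Qed.

Lemma within_ge0_continuousP (U : topologicalType) (f : R -> U) :
  {within `[0, +oo[, continuous f} <-> continuous (f \o clip).
Proof.
split=> [/subspace_continuousP fc t|fc].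
  have c0 : `[0, +oo[%classic (clip t) by rewrite /= in_itv/= clip_ge0.
  move=> A /(fc _ c0) /(@continuous_clip t); rewrite nbhs_simpl /= => h.
  apply: filterS h => s /=; apply.
  by rewrite in_itv/= clip_ge0.
apply: (@subspace_eq_continuous _ _ _ (f \o clip : subspace `[0, +oo[ -> U)).
  by move=> t; rewrite inE/= in_itv/= andbT => t0; rewrite /from_subspace/= clipE.
exact: continuous_subspaceT.
Qed.

(** A modulus of continuity of [M] serves for [L]; iterates and limit thus become continuous without
    any uniform convergence. *)
Lemma increment_continuous (L M : R -> R) :
  (forall s t, 0 <= s -> s <= t -> 0 <= L t - L s <= M t - M s) ->
  continuous (M \o clip) -> continuous (L \o clip).
Proof.
move=> LM cM t; apply/cvgrPdist_lt => e e0.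
have /cvgrPdist_lt /(_ _ e0) := cM t; apply: filterS => s /=; apply: le_lt_trans.
have h a b : a <= b -> `|L (clip a) - L (clip b)| <= `|M (clip a) - M (clip b)|.
  move=> ab; have /andP[L0 LM'] := LM _ _ (clip_ge0 a) (clip_homo ab).
  by rewrite 2!(distrC (_ (clip a))) !ger0_norm// (le_trans L0).
have [|/ltW] := leP t s; first exact: h.
by rewrite 2!(distrC (_ (clip t))); exact: h.
Qed.

(** If [e > 0] is the minimum of [x + L] on [[a, b]], then [- x s <= L s - e <= L b - e] there, so
    [L b <= max (L a) (L b - e)], which forces [L b <= L a]. *)
Lemma running_sup_flat (x L : R -> R) (a b : R) :
  is_running_sup (fun t => - x t) L -> continuous (fun t => x (clip t) + L (clip t)) ->
  0 <= a -> a <= b -> (forall s, a <= s <= b -> 0 < x s + L s) -> L a = L b.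
Proof.
move=> xL cZ a0 ab Zpos; have b0 := le_trans a0 ab.
have [c] := EVT_min ab (continuous_subspaceT cZ).
rewrite in_itv/= => /andP[ac cb] cmin.
have c0 := le_trans a0 ac.
have e0 : 0 < x c + L c by apply: Zpos; rewrite ac.
have Lab := is_running_sup_homo xL a0 ab.
have [_ _ Lb] := xL b b0; have [La0 xLa _] := xL a a0.
suff : L b <= Num.max (L a) (L b - (x c + L c)) by rewrite le_max; lra.
apply: Lb => [|s /andP[s0 sb]]; first by rewrite le_max La0.
have [sa|/ltW as'] := leP s a; first by rewrite le_max xLa ?s0.
have := cmin s; rewrite in_itv/= as' sb => /(_ isT).
have Lsb := is_running_sup_homo xL s0 sb.
by rewrite !clipE// le_max; lra.
Qed.

Lemma measure_ocitv (c : cumulative R R) (a b : R) : a <= b ->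
  lebesgue_stieltjes_measure c `]a, b]%classic = (c b - c a)%:E.
Proof.
move=> ab; rewrite /lebesgue_stieltjes_measure/= /measure_extension/=.
rewrite measurable_mu_extE/=; last exact: is_ocitv.
by rewrite wlength_itv_bnd.
Qed.

Section StieltjesZero.
Variables x L : R -> R.
Let Z t := x t + L t.
Hypothesis cL : continuous (L \o clip).
Hypothesis cZ : continuous (Z \o clip).
Hypothesis Z0 : forall t, 0 <= t -> 0 <= Z t.

Let mZ : measurable_fun (`[0, +oo[%classic : set R) (fun t => (Z t)%:E).
Proof.
apply/measurable_EFinP; apply: subspace_continuous_measurable_fun => //.
exact/within_ge0_continuousP.
Qed.

(** Minimality is by contradiction: if some bound [u] were below [L t], then [Z] would be bounded
    away from 0 on an interval charged by [dL]. *)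
Lemma stieltjes_zero_running_sup :
  (forall s t, 0 <= s -> s <= t -> L s <= L t) -> L 0 = 0 ->
  stieltjes_zero Z L -> is_running_sup (fun t => - x t) L.
Proof.
move=> L_nd L0 ZL t t0; split.
- by rewrite -L0 L_nd.
- move=> s /andP[s0 st]; have := Z0 s0; have := L_nd s t s0 st; rewrite /Z; lra.
move=> u u0 xu; rewrite leNgt; apply/negP => uL.
pose g (t : R) := L (clip t).
have g_nd : {homo g : s t / s <= t}.
  by move=> r s rs; apply: L_nd; [exact: clip_ge0|exact: clip_homo].
have g_rc : right_continuous g by apply: right_continuousW; exact: cL.
pose gC := isCumulative.Build R _ R g g_nd g_rc.
pose c : cumulative R R := HB.pack g gC.
have cg r : c r = g r by [].
(* [L] takes the midpoint of [u] and [L t] at some time [a]. With [e] half of [L t - u], both the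
   [dL]-mass of []a, t]] and a lower bound of [Z] on it equal [e], so the integral is at least
   [e * e]. *)
have gu : Num.min (g 0) (g t) <= (u + L t) / 2 <= Num.max (g 0) (g t).
  by rewrite /g !clipE// L0 ge_min le_max; apply/andP; split; apply/orP;
    [left|right]; lra.
have [a] := IVT t0 (continuous_subspaceT cL) gu.
rewrite in_itv/= => /andP[a0 aT] ga.
pose e := (L t - u) / 2.
have e0 : 0 < e by rewrite /e; lra.
have ac : `]a, t]%classic `<=` (`[0, +oo[%classic : set R).
  by move=> s /=; rewrite !in_itv/= => /andP[as' _]; rewrite andbT (le_trans a0) ?ltW.
have := ZL c erefl; apply/eqP; rewrite gt_eqF//.
apply: (@lt_le_trans _ _
  (\int[lebesgue_stieltjes_measure c]_(s in `]a, t]%classic) cst e%:E s)%E).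
  rewrite integral_cst//= measure_ocitv// -EFinM lte_fin mulr_gt0//.
  by rewrite !cg /g ga clipE// /e; lra.
apply: (@le_trans _ _
  (\int[lebesgue_stieltjes_measure c]_(s in `]a, t]%classic) (Z s)%:E)%E); last first.
  apply: ge0_subset_integral => // s /=.
  by rewrite in_itv/= andbT lee_fin; exact: Z0.
apply: ge0_le_integral => //.
- by move=> s _; rewrite lee_fin ltW.
- exact: (measurable_funS (measurable_itv _) ac mZ).
move=> s; rewrite /= in_itv/= => /andP[/ltW as' st].
have s0 := le_trans a0 as'.
have := xu s; rewrite s0 st => /(_ isT); have := L_nd a s a0 as'.
by move: ga; rewrite /g clipE// lee_fin /Z /e; lra.
Qed.

(** The set where [Z > 0] is covered by countably many rational intervals on which [Z] stays
    positive; [L] is flat on each, so the set is [dL]-null and the integrand vanishes almost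
    everywhere. *)
Lemma running_sup_stieltjes_zero :
  is_running_sup (fun t => - x t) L -> stieltjes_zero Z L.
Proof.
move=> xL c cE.
have near_pos (t : R) : 0 <= t -> 0 < Z t ->
    exists2 e, 0 < e & forall s, t - e < s < t + e -> 0 < Z (clip s).
  move=> t0 Zt; have Zt' : 0 < (Z \o clip) t by rewrite /= clipE.
  have /(_ _)/nbhs_ballP[e /= e0 eZ] := cvgr_gt _ (@cZ t) _ Zt'.
  by exists e => // s st; apply: eZ; rewrite /ball/= ltr_distlC.
set mu := lebesgue_stieltjes_measure c.
rewrite (ae_eq_integral (cst 0%E)) ?integral0//.
(* Enumeration of rational pairs; a code of no pair yields the empty interval []0, 0]]. *)
pose pq k : rat * rat := odflt (0, 0) (unpickle k).
pose p k : R := ratr (pq k).1; pose q k : R := ratr (pq k).2.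
pose N k : set R := [set t | p k < t <= q k /\
  forall s, p k <= s <= q k -> 0 < Z (clip s)].
have Nnull k : mu.-negligible (N k).
  have [pos|npos] := pselect (forall s, p k <= s <= q k -> 0 < Z (clip s)); last first.
    suff -> : N k = set0 by exact: negligible_set0.
    by rewrite -subset0 => t [].
  have [pq'|qp] := leP (p k) (q k); last first.
    suff -> : N k = set0 by exact: negligible_set0.
    rewrite -subset0 => t [/andP[pt tq] _].
    by have := lt_le_trans pt tq; rewrite ltNge (ltW qp).
  exists `]p k, q k]%classic; split => //; last by move=> t [? _] /=; rewrite in_itv.
  rewrite [LHS]measure_ocitv// cE -!/(clip _).
  rewrite (@running_sup_flat x L (clip (p k)) (clip (q k))) ?subrr ?clip_ge0 ?clip_homo//.
  move=> s /andP[ps sq].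
  have s0 := le_trans (clip_ge0 _) ps.
  (* Rational endpoints may be negative. When [q k < 0] the clipped interval is the single point
     0. *)
  have [q0|q0] := leP 0 (q k).
    rewrite -(clipE s0); apply: pos; rewrite -[q k]clipE// sq andbT.
    by apply: le_trans ps; rewrite /clip le_max lexx.
  have -> : s = clip (q k).
    by apply/eqP; rewrite eq_le sq [clip _]max_r// ltW.
  by apply: pos; rewrite lexx andbT.
have [N' [mN' N'0 NN']] := negligible_bigcup Nnull.
exists N'; split => // t; rewrite /= in_itv/= andbT => tZ; apply: NN'.
have [t0 Zt] : 0 <= t /\ 0 < Z t.
  move: tZ => /not_implyP[t0 Zt]; split => //; rewrite lt_neqAle Z0// andbT.
  by apply/eqP => Zt0; apply: Zt; rewrite -Zt0.
have [e e0 eZ] := near_pos t t0 Zt.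
have /rat_in_itvoo[p' /itvP p'P] : t - e < t by lra.
have /rat_in_itvoo[q' /itvP q'P] : t < t + e by lra.
exists (pickle (p', q')) => //; rewrite /N /p /q /pq pickleK /=; split.
  by rewrite p'P ltW ?q'P.
move=> s /andP[ps sq]; apply: eZ.
by rewrite (lt_le_trans _ ps) ?p'P// (le_lt_trans sq) ?q'P.
Qed.

End StieltjesZero.
End Paths.

(** * Measurability of path functionals through rational times *)

Section PathMeasurability.
Variable R : realType.

Lemma continuous_gt_rat (g : R -> R) (t e : R) : continuous g -> e < g t ->
  exists q : rat, e < g (ratr q).
Proof.
move=> cg egt; have /(_ _)/nbhs_ballP[r /= r0 rg] := cvgr_gt _ (cg t) _ egt.
have /rat_in_itvoo[q /itvP qP] : t < t + r by lra.
exists q; apply: rg; rewrite /ball/= ltr_distlC qP andbT.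
by rewrite (@lt_trans _ _ t) ?qP//; lra.
Qed.

Lemma continuous_lt_rat (g : R -> R) (t e : R) : continuous g -> g t < e ->
  exists q : rat, g (ratr q) < e.
Proof.
move=> cg gte; have [||q] := @continuous_gt_rat (fun s => - g s) t (- e).
- by move=> s; apply: cvgN; exact: cg.
- by rewrite ltrN2.
by rewrite ltrN2; exists q.
Qed.

(** Retraction onto [[a, b]]: sampling at clamped rationals is dense in [[a, b]] even when the
    interval is a point or has irrational endpoints. *)
Definition clamp (a b s : R) := Num.min (Num.max s a) b.

Lemma clamp_itv a b s : a <= b -> a <= clamp a b s <= b.
Proof. by move=> ab; rewrite /clamp le_min ge_min le_max !lexx ab !orbT. Qed.

Lemma clampE a b s : a <= s <= b -> clamp a b s = s.
Proof. by move=> /andP[as' sb]; rewrite /clamp max_l// min_l. Qed.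

Lemma continuous_clamp (f : R -> R) a b : continuous (f \o clip (R:=R)) ->
  0 <= a -> a <= b -> continuous (f \o clamp a b).
Proof.
move=> cf a0 ab; rewrite (_ : f \o _ = (f \o clip (R:=R)) \o clamp a b).
  move=> t; apply: continuous_comp; last exact: cf.
  apply: continuous_min; last exact: cvg_cst.
  by apply: continuous_max; [exact: cvg_id|exact: cvg_cst].
apply/funext => s /=; rewrite clipE//.
by have /andP[+ _] := clamp_itv s ab; apply: le_trans.
Qed.

Lemma measurable_bigcup_rat d (T : measurableType d) (F : rat -> set T) :
  (forall q, measurable (F q)) -> measurable (\bigcup_q F q).
Proof.
move=> mF; pose dec n : rat := odflt 0 (unpickle n).
rewrite (_ : \bigcup_q F q = \bigcup_n F (dec n)).
  by apply: bigcupT_measurable => n; exact: mF.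
apply/seteqP; split => [w [q _ Fw]|w [n _ Fw]]; last by exists (dec n).
by exists (pickle q) => //; rewrite /dec pickleK.
Qed.

Context {d : measure_display} {T : measurableType d}.

(** By continuity, [S t] exceeds [u >= 0] iff [y] does at some clamped rational time. Only times up
    to [t] occur, so with the sigma-algebra [F t] this yields adaptedness. *)
Lemma measurable_running_sup (y S : R -> T -> R) (t : R) : 0 <= t ->
  (forall s, 0 <= s -> s <= t -> measurable_fun setT (y s)) ->
  (forall w, continuous ((y^~ w) \o clip (R:=R))) ->
  (forall w, is_running_sup (y^~ w) (S^~ w)) ->
  measurable_fun setT (S t).
Proof.
move=> t0 my cy yS mT; apply: (measurability _ (RGenOInfty.measurableE R)) => //.
move=> _ [_ [u ->] <-]; rewrite setTI.
have [u0|u0] := ltP u 0.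
  rewrite (_ : _ @^-1` _ = setT)//; apply/seteqP; split => // w _ /=.
  by rewrite in_itv/= andbT (lt_le_trans u0)//; have [] := yS w t t0.
rewrite (_ : _ @^-1` _ =
    \bigcup_(q : rat) (y (clamp 0 t (ratr q)) @^-1` `]u, +oo[)).
  apply: measurable_bigcup_rat => q.
  have /andP[c0 ct] := clamp_itv (ratr q) t0.
  by rewrite -[X in measurable X]setTI; apply: my.
apply/seteqP; split => [w /=|w [q _ /=]]; rewrite !in_itv/= !andbT; last first.
  move=> /lt_le_trans; apply; have [_ + _] := yS w t t0; apply.
  exact: clamp_itv.
move=> uS; have [s st us] : exists2 s, 0 <= s <= t & u < y s w.
  apply: contrapT => /forall2NP h; move: uS; apply/negP; rewrite -leNgt.
  have [_ _] := yS w t t0; apply=> // s st.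
  by have [//|/negP] := h s; rewrite -leNgt.
have [|q uq] := @continuous_gt_rat _ s u (continuous_clamp (cy w) (lexx 0) t0).
  by rewrite /= clampE.
by exists q => //=; rewrite in_itv/= andbT.
Qed.

(** The positive times are exhausted by the compact intervals [[1/(n+1), n+1]]. On each, a
    continuous nonnegative path attains its minimum, so it has a zero iff it gets below every
    [1/(k+1)] at some clamped rational time. *)
Lemma measurable_hit_zero (f : R -> T -> R) :
  (forall t, 0 <= t -> measurable_fun setT (f t)) ->
  (forall w, continuous ((f^~ w) \o clip (R:=R))) ->
  (forall t w, 0 <= t -> 0 <= f t w) ->
  measurable [set w | exists t, 0 < t /\ f t w = 0].
Proof.
move=> mf cf f0.
pose a n : R := n.+1%:R^-1; pose b n : R := n.+1%:R.
have a0 n : 0 < a n by rewrite invr_gt0.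
have ab n : a n <= b n.
  by rewrite /a /b (@le_trans _ _ 1) ?invf_le1 ?ler1n.
pose E n k q := (f (clamp (a n) (b n) (ratr q)) @^-1` `]-oo, a k[ : set T).
rewrite (_ : [set w | _] = \bigcup_n \bigcap_k \bigcup_q E n k q).
  apply: bigcupT_measurable => n; apply: bigcapT_measurable => k.
  apply: measurable_bigcup_rat => q.
  rewrite -[X in measurable X]setTI; apply: mf => //.
  have /andP[+ _] := clamp_itv (ratr q) (ab n); apply: le_trans; exact/ltW.
apply/seteqP; split => w; have cfn n := continuous_clamp (cf w) (ltW (a0 n)) (ab n).
  move=> [t [t0 ftw]]; have [n nt] : exists n, a n <= t <= b n.
    pose n := maxn (Num.truncn t) (Num.truncn t^-1); exists n.
    have le_n (r : R) : 0 < r -> (Num.truncn r <= n)%N -> r <= n.+1%:R.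
      move=> r0 rn; apply: le_trans (ltW (truncnS_gt r)) _.
      by rewrite ler_nat ltnS.
    apply/andP; split; last by apply: le_n; rewrite // leq_maxl.
    rewrite -[leRHS]invrK lef_pV2 ?posrE ?invr_gt0//.
    by apply: le_n; rewrite ?invr_gt0// leq_maxr.
  exists n => // k _.
  have [|q qk] := @continuous_lt_rat _ t (a k) (cfn n).
    by rewrite /= clampE// ftw.
  by exists q => //; rewrite /E/= in_itv.
move=> [n _ nE]; have [c] := EVT_min (ab n) (continuous_subspaceT (cfn n)).
rewrite in_itv/= => cn cmin; have /andP[nc _] := cn.
have c0 := lt_le_trans (a0 n) nc.
exists c; split => //; apply/eqP; rewrite eq_le (f0 c w (ltW c0)) andbT leNgt.
apply/negP => fc.
(* Chosen so that [1/(k+1)] is below the positive minimum [f c w]. *)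
pose k := Num.truncn (f c w)^-1.
have [q _] := nE k I; rewrite /E/= in_itv/= => fq.
have := cmin (clamp (a n) (b n) (ratr q)); rewrite in_itv/= clamp_itv// => /(_ isT).
rewrite /= (clampE cn) (clampE (clamp_itv _ (ab n))) => fcq.
have : a k < f c w.
  rewrite /a -[ltRHS]invrK ltf_pV2 ?posrE ?invr_gt0//.
  exact: truncnS_gt.
by rewrite ltNge (le_trans fcq)// ltW.
Qed.

End PathMeasurability.

(** * Adapted processes and measurability of hitting events *)

Section Adapted.
Context {R : realType} {d : measure_display} {T : measurableType d}.

Lemma sub_sigma_measurableP (G : set (set T)) (f : T -> R) : sigma_algebra setT G ->
  (forall V : set R, measurable V -> G [set w | f w \in V]) <->
  measurable_fun [set: g_sigma_algebraType G] f.
Proof.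
move=> sG; have GE : <<s G >> = G by exact: sigma_algebra_id.
have fE V : [set w | f w \in V] = setT `&` f @^-1` V.
  by rewrite setTI; apply/seteqP; split => w /=; rewrite inE.
split=> [Gf _ V mV|mf V mV].
  by rewrite -fE; rewrite /measurable/= GE; exact: Gf.
by have := mf measurableT V mV; rewrite -fE /measurable/= GE.
Qed.

End Adapted.

Section Processes.
Context {R : realType} {dO : measure_display} {Omega : measurableType dO}.
Implicit Types (F : R -> set (set Omega)).

Lemma continuous_col n (f : R -> 'cV[R]_n) :
  (forall i, continuous (fun t => f t i 0)) -> continuous f.
Proof.
move=> cf t A [U fU sUA].
have Uij i j : \forall s \near t, U i j (f s i j).
  by have := @cf i t (U i j); rewrite (ord1 j); apply; exact: fU.
have Ui : \forall s \near t, forall i j, U i j (f s i j).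
  apply: (@filter_forall _ _ (fun i s => forall j, U i j (f s i j)) (nbhs t)) => i.
  exact: (@filter_forall _ _ (fun j s => U i j (f s i j)) (nbhs t) _ (Uij i)).
by rewrite nbhs_simpl; apply: filterS Ui => s; exact: sUA.
Qed.

Lemma cont_pathsP n (X : R -> Omega -> 'cV[R]_n) :
  cont_paths X <-> forall w i, continuous ((fun t => X t w i 0) \o clip (R:=R)).
Proof.
split=> [cX w i|cX w]; last first.
  by apply/within_ge0_continuousP; apply: continuous_col => i; exact: cX.
have /within_ge0_continuousP cXw := cX w.
move=> t; apply: (@continuous_comp _ _ _ _ (fun M : 'cV[R]_n => M i 0)) (cXw t) _.
exact: coord_continuous.
Qed.

Lemma adaptedP n F (X : R -> Omega -> 'cV[R]_n) : is_filtration F ->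
  adapted F X <->
  forall t, 0 <= t -> forall i, measurable_fun [set: g_sigma_algebraType (F t)]
    (fun w => X t w i 0).
Proof.
move=> [sF _]; split=> aX t t0 i.
  by apply/(sub_sigma_measurableP _ (sF t t0)) => V mV; exact: aX.
by move=> V mV; apply: (sub_sigma_measurableP _ (sF t t0)).2 => //; exact: aX.
Qed.

Lemma sub_filtration_measurable F s t (f : Omega -> R) : is_filtration F ->
  0 <= s -> s <= t ->
  measurable_fun [set: g_sigma_algebraType (F s)] f ->
  measurable_fun [set: g_sigma_algebraType (F t)] f.
Proof.
move=> [sF [_ mono]] s0 st /(sub_sigma_measurableP _ (sF s s0)) fs.
apply/(sub_sigma_measurableP _ (sF t (le_trans s0 st))) => V mV.
by apply: (mono s t s0 st); exact: fs.
Qed.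

(** Nonnegative coordinates all vanish iff their sum does, which reduces the event to zeros of a
    scalar path. Measurability is what permits comparing probabilities by inclusion. *)
Lemma measurable_hit_face n F (X : R -> Omega -> 'cV[R]_n) (J : {set 'I_n}) :
  is_filtration F -> cont_paths X -> adapted F X ->
  (forall t w, 0 <= t -> orthant (X t w)) ->
  measurable [set w | exists t, 0 < t /\ face J (X t w)].
Proof.
move=> [_ [Fm _]] /cont_pathsP cX aX X0.
rewrite (_ : [set w | _] =
    [set w | exists t, 0 < t /\ \sum_(i in J) X t w i 0 = 0]); last first.
  apply/seteqP; split => w [t [t0 H]]; exists t; split => //.
    by case: H => _ XJ; rewrite big1.
  have Xt0 := X0 t w (ltW t0); split => // i iJ; apply/eqP.
  by move/eqP: H; rewrite psumr_eq0// => /allP/(_ i); rewrite mem_index_enum iJ; exact.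
apply: (@measurable_hit_zero _ _ _ (fun t w => \sum_(i in J) X t w i 0)).
- move=> t t0.
  rewrite [X in measurable_fun _ X](_ : _ = (fun w => \sum_(i <- enum J) X t w i 0)).
    apply: measurable_sum => i _ V mV; rewrite setTI; apply: (Fm t t0).
    have := aX t t0 i V mV; congr (F t _); apply/seteqP.
    by split=> w /=; rewrite inE.
  by apply/funext => w; rewrite big_enum.
- move=> w; apply: continuous_big => [|i _]; last exact: cX.
  exact: add_continuous.
- by move=> t w t0; apply: sumr_ge0 => i _; exact: X0.
Qed.

End Processes.

(** * Restriction of vectors, matrices and Brownian motion to [I] *)

Section Restriction.
Context {R : realType} {d : nat} (I : {set 'I_d}).

Definition select : 'M[R]_(#|I|, d) := \matrix_(k, i) (enum_val k == i)%:R.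

Lemma select_mulE n (C : 'M[R]_(d, n)) k j : (select *m C) k j = C (enum_val k) j.
Proof.
rewrite mxE (bigD1 (enum_val k))//= mxE eqxx mul1r big1 ?addr0// => i ik.
by rewrite mxE eq_sym (negPf ik) mul0r.
Qed.

Lemma subvecE x : subvec I x = select *m x.
Proof. by apply/matrixP => k j; rewrite select_mulE mxE ord1. Qed.

Lemma submatE (C : 'M[R]_d) : submat I C = select *m C *m select^T.
Proof.
apply/matrixP => k l; rewrite mxE -mulmxA select_mulE.
by rewrite -[C *m _]trmxK trmx_mul trmxK mxE select_mulE mxE.
Qed.

(** A linear form [u] of the restriction is the form [select^T *m u] of the full process, which
    transports mean and variance. *)
Lemma is_BM_subvec {dO : measure_display} {Omega : measurableType dO}
    (P : probability Omega R) F mu A z (B : R -> Omega -> 'cV[R]_d) :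
  is_BM P F mu A z B ->
  is_BM P F (subvec I mu) (submat I A) (subvec I z) (fun t w => subvec I (B t w)).
Proof.
move=> [/cont_pathsP cB [aB [B0 incB]]]; split.
  apply/cont_pathsP => w k.
  rewrite (_ : _ \o _ = (fun t => B t w (enum_val k) 0) \o clip (R:=R)) //.
  by apply/funext => t /=; rewrite mxE.
split.
  move=> t t0 k V mV; have := aB t t0 (enum_val k) V mV.
  by congr (F t _); apply/seteqP; split => w /=; rewrite mxE.
split=> [w|s t s0 st]; first by rewrite B0.
have [gB iB] := incB s t s0 st; split.
  move=> u V mV; rewrite !subvecE submatE !mulmxA.
  have uE : u^T *m select = (select^T *m u)^T by rewrite trmx_mul trmxK.
  rewrite uE -(mulmxA _ select^T u) -gB//; congr (P _).
  by apply/seteqP; split => w /=; rewrite !subvecE -mulmxBr mulmxA uE.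
move=> E U FE mU.
(* For [i] outside [I] this is an empty intersection, hence the whole line: no constraint on that
   coordinate. *)
pose U' i := \bigcap_(k in [set k : 'I_#|I| | enum_val k = i]) U k.
have U'E : [set w | forall k, (subvec I (B t w) - subvec I (B s w)) k 0 \in U k] =
           [set w | forall i, (B t w - B s w) i 0 \in U' i].
  apply/seteqP; split => w /= H i.
    by rewrite inE => k /= <-; have := H k; rewrite inE !mxE.
  by have := H (enum_val i); rewrite !inE !mxE => /(_ i erefl).
rewrite U'E; apply: iB => // i.
by apply: fin_bigcap_measurable => // k _; exact: mU.
Qed.

End Restriction.

(** * The reduced SRBM on the given probability space *)

Section Comparison.
Context {R : realType} {d : nat} (I : {set 'I_d}).
Context {dO : measure_display} {Omega : measurableType dO}.
Variables (P : probability Omega R) (F : R -> set (set Omega)).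
Variables (Rm A : 'M[R]_d) (mu z : 'cV[R]_d) (B L Z : R -> Omega -> 'cV[R]_d).
Hypothesis Rm_diag : forall i, Rm i i = 1.
Hypothesis Rm_off : forall i j, i != j -> Rm i j <= 0.
Hypothesis Z_SRBM : is_SRBM P Rm mu A z F B L Z.

Let Q : 'M[R]_#|I| := 1%:M - submat I Rm.
Let b w (k : 'I_#|I|) t := B t w (enum_val k) 0.
Let M w (k : 'I_#|I|) t := L t w (enum_val k) 0.
(** The downward push on coordinate [k] by regulators outside [I], with its sign reversed; it is
    nondecreasing because [Rm] is nonpositive off the diagonal. *)
Let W w (k : 'I_#|I|) t := \sum_(j | j \notin I) - Rm (enum_val k) j * L t w j 0.

Definition face_L t w : 'cV[R]_#|I| := \col_k reg_lim Q (b w) k t.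
Definition face_Z t w : 'cV[R]_#|I| := subvec I (B t w) + submat I Rm *m face_L t w.

Let Q0 k l : 0 <= Q k l.
Proof.
rewrite !mxE; have [->|kl] := eqVneq k l; first by rewrite Rm_diag subrr.
by rewrite sub0r oppr_ge0 Rm_off// (inj_eq enum_val_inj).
Qed.

Let submat_mulE (x : 'cV[R]_#|I|) k :
  (submat I Rm *m x) k 0 = x k 0 - \sum_l Q k l * x l 0.
Proof.
have -> : submat I Rm = 1%:M - Q by rewrite /Q subKr.
by rewrite mulmxBl mul1mx !mxE.
Qed.

Let L0 w k : L 0 w k 0 = 0.
Proof. by case: Z_SRBM => _ [_ [_ [_ [_ [_ [_ [_ [+ _]]]]]]]]; exact. Qed.

Let L_homo w k s t : 0 <= s -> s <= t -> L s w k 0 <= L t w k 0.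
Proof. by case: Z_SRBM => _ [_ [_ [_ [_ [_ [_ [_ [_ [+ _]]]]]]]]]; exact. Qed.

Let L_stieltjes w k : stieltjes_zero (fun t => Z t w k 0) (fun t => L t w k 0).
Proof. by case: Z_SRBM => _ [_ [_ [_ [_ [_ [_ [_ [_ [_ +]]]]]]]]]; exact. Qed.

Let ZE t w : 0 <= t -> Z t w = B t w + Rm *m L t w.
Proof. by case: Z_SRBM => _ [_ [_ [_ [_ [_ [_ [+ _]]]]]]]; exact. Qed.

Let cB : cont_paths B. Proof. by case: Z_SRBM => _ [[]]. Qed.
Let aB : adapted F B. Proof. by case: Z_SRBM => _ [[_ []]]. Qed.
Let cL : cont_paths L. Proof. by case: Z_SRBM => _ [_ [_ [_ [_ []]]]]. Qed.
Let cZ : cont_paths Z. Proof. by case: Z_SRBM => _ [_ []]. Qed.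
Let filtF : is_filtration F. Proof. by case: Z_SRBM. Qed.
Let Z_ge0 t w : 0 <= t -> orthant (Z t w).
Proof. by case: Z_SRBM => _ [_ [_ [_ [+ _]]]]; exact. Qed.

Let M0 w k : M w k 0 = 0. Proof. exact: L0. Qed.

Let W0 w k : W w k 0 = 0.
Proof. by rewrite /W big1// => j _; rewrite L0 mulr0. Qed.

Let W_homo w k s t : 0 <= s -> s <= t -> W w k s <= W w k t.
Proof.
move=> s0 st; apply: ler_sum => j jI; apply: ler_wpM2l; last exact: L_homo.
rewrite oppr_ge0 Rm_off//; apply/eqP => jE.
by move: jI; rewrite -jE enum_valP.
Qed.

Let Z_pull w k t : 0 <= t ->
  Z t w (enum_val k) 0 = M w k t - (pull Q (b w) (M w) k t + W w k t).
Proof.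
move=> t0; rewrite ZE// mxE; set Ls := subvec I (L t w).
have -> : (Rm *m L t w) (enum_val k) 0 = (submat I Rm *m Ls) k 0 - W w k t.
  rewrite mxE (bigID (mem I))/= big_enum_val /W -sumrN; congr (_ + _).
    by rewrite mxE; apply: eq_bigr => l _; rewrite !mxE.
  by apply: eq_bigr => j _; rewrite mulNr opprK.
rewrite submat_mulE mxE /pull /M /b.
under eq_bigr do rewrite [Ls _ _]mxE.
ring.
Qed.

(** Complementarity, read one coordinate at a time with all other regulators frozen into the free
    path, identifies [L] on [I] as a solution of the perturbed equation. *)
Let M_sup w k : is_running_sup (fun t => pull Q (b w) (M w) k t + W w k t) (M w k).
Proof.
pose x t := Z t w (enum_val k) 0 - M w k t.
have xME : (fun t => x t + M w k t) = (fun t => Z t w (enum_val k) 0).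
  by apply/funext => t; rewrite subrK.
apply: (@eq_is_running_sup _ (fun t => - x t)) => [s s0|].
  by rewrite /x Z_pull//; ring.
apply: stieltjes_zero_running_sup.
- exact: ((cont_pathsP L).1 cL w (enum_val k)).
- by rewrite xME; exact: ((cont_pathsP Z).1 cZ w (enum_val k)).
- by move=> t t0; rewrite /x subrK; exact: Z_ge0.
- exact: L_homo.
- exact: L0.
- by rewrite xME; exact: L_stieltjes.
Qed.

Let N w k := reg_lim Q (b w) k.

Let N_sup w k : is_running_sup (pull Q (b w) (N w) k) (N w k).
Proof. exact: (reg_limP Q0 (W0 w) (@W_homo w) (M_sup w)). Qed.

Let cM w k : continuous (M w k \o clip (R:=R)).
Proof. exact: ((cont_pathsP L).1 cL w (enum_val k)). Qed.

Let cN w k : continuous (N w k \o clip (R:=R)).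
Proof.
apply: (increment_continuous (M := M w k)); last exact: cM.
move=> s t s0 st; rewrite subr_ge0 (is_running_sup_homo (N_sup w k))//=.
exact: (reg_lim_incr Q0 (W0 w) (@W_homo w) (M_sup w)).
Qed.

Let cont_pull w (X : 'I_#|I| -> R -> R) k :
  (forall l, continuous (X l \o clip (R:=R))) ->
  continuous (pull Q (b w) X k \o clip (R:=R)).
Proof.
move=> cX t; apply: cvgB; last exact: ((cont_pathsP B).1 cB w (enum_val k) t).
apply: cvg_big => [|l _]; first exact: add_continuous.
by apply: cvgM; [exact: cvg_cst|exact: cX].
Qed.

Let face_Z_pull t w k : face_Z t w k 0 = N w k t - pull Q (b w) (N w) k t.
Proof.
have NE l : face_L t w l 0 = N w l t by rewrite mxE.
rewrite mxE submat_mulE mxE NE /pull /b.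
under eq_bigr do rewrite NE.
ring.
Qed.

(** Induction on [n]: the pull at [s <= t] is measurable for [F s], hence for [F t], and the running
    supremum preserves this. *)
Let reg_iter_adapted n k t : 0 <= t ->
  measurable_fun [set: g_sigma_algebraType (F t)] (fun w => reg_iter Q (b w) n k t).
Proof.
elim: n k t => [|n IHn] k t t0; first exact: measurable_cst.
apply: (@measurable_running_sup _ _ (g_sigma_algebraType (F t))
  (fun s w => pull Q (b w) (reg_iter Q (b w) n) k s)
  (fun s w => reg_iter Q (b w) n.+1 k s)) => //.
- move=> s s0 st; apply: measurable_funB.
    apply: measurable_sum => l; apply: measurable_funM; first exact: measurable_cst.
    exact: sub_filtration_measurable (IHn l s s0).
  apply: (sub_filtration_measurable filtF s0 st).
  exact: ((adaptedP B filtF).1 aB s s0 (enum_val k)).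
- move=> w; apply: cont_pull => l; apply: (increment_continuous (M := M w l)); last exact: cM.
  move=> r s r0 rs; rewrite subr_ge0.
  rewrite (reg_iter_homo Q0 (W0 w) (@W_homo w) (M_sup w))//=.
  exact: (reg_iter_incr Q0 (W0 w) (@W_homo w) (M_sup w)).
- by move=> w; exact: (reg_iterP Q0 (W0 w) (@W_homo w) (M_sup w)).
Qed.

Let N_adapted k t : 0 <= t ->
  measurable_fun [set: g_sigma_algebraType (F t)] (fun w => N w k t).
Proof.
move=> t0; apply: (measurable_fun_cvg (fun n => reg_iter_adapted n k t0)) => w _.
exact: (reg_iter_cvg Q0 (W0 w) (@W_homo w) (M_sup w)).
Qed.

Lemma face_Z_ge0 t w : 0 <= t -> orthant (face_Z t w).
Proof.
move=> t0 k; rewrite face_Z_pull subr_ge0.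
by have [_ + _] := N_sup w k t0; apply; rewrite t0 lexx.
Qed.

Lemma le_face_Z t w k : 0 <= t -> Z t w (enum_val k) 0 <= face_Z t w k 0.
Proof.
move=> t0; rewrite face_Z_pull Z_pull//.
have := reg_lim_gap Q0 (W0 w) (@W_homo w) (M_sup w) k t0.
by rewrite /N; lra.
Qed.

Lemma face_Z_SRBM :
  is_SRBM P (submat I Rm) (subvec I mu) (submat I A) (subvec I z) F
    (fun t w => subvec I (B t w)) face_L face_Z.
Proof.
have cfL : cont_paths face_L.
  apply/cont_pathsP => w k.
  rewrite (_ : _ \o _ = N w k \o clip (R:=R)); first exact: cN.
  by apply/funext => t /=; rewrite mxE.
have cfZ : cont_paths face_Z.
  apply/cont_pathsP => w k t.
  rewrite (_ : _ \o _ = fun s =>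
    (N w k \o clip (R:=R)) s - (pull Q (b w) (N w) k \o clip (R:=R)) s).
    by apply: cvgB; [exact: cN|exact: (@cont_pull w (N w) k (@cN w) t)].
  by apply/funext => s /=; rewrite face_Z_pull.
split=> //; split; first by apply: is_BM_subvec; case: Z_SRBM => _ [].
split=> //; split.
  apply/adaptedP => // t t0 k.
  rewrite (_ : (fun w => _) = (fun w => N w k t - pull Q (b w) (N w) k t)).
    apply: measurable_funB; first exact: N_adapted.
    apply: measurable_funB; last exact: ((adaptedP B filtF).1 aB t t0 (enum_val k)).
    apply: measurable_sum => l; apply: measurable_funM; first exact: measurable_cst.
    exact: N_adapted.
  by apply/funext => w; rewrite face_Z_pull.
split; first by move=> t w; exact: face_Z_ge0.
split=> //; split.
  apply/adaptedP => // t t0 k.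
  by under eq_fun do rewrite mxE; exact: N_adapted.
split=> //.
split.
  by move=> w k; rewrite mxE; exact: (reg_lim0 Q0 (M0 w) (W0 w) (@W_homo w) (M_sup w)).
split.
  by move=> w k s t s0 st; rewrite !mxE; exact: (is_running_sup_homo (N_sup w k)).
move=> w k.
have -> : (fun t => face_L t w k 0) = N w k by apply/funext => t; rewrite mxE.
have -> : (fun t => face_Z t w k 0) = (fun t => - pull Q (b w) (N w) k t + N w k t).
  by apply/funext => t; rewrite face_Z_pull addrC.
apply: running_sup_stieltjes_zero.
- move=> t; apply: cvgD; last exact: (@cN w k t).
  by apply: cvgN; exact: (@cont_pull w (N w) k (@cN w) t).
- by move=> t t0; rewrite addrC -face_Z_pull; exact: face_Z_ge0.
by apply: eq_is_running_sup (N_sup w k) => s _; rewrite opprK.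
Qed.

End Comparison.

Theorem theorem3p7 (R : realType) (d : nat) (Rm : 'M[R]_d) (mu : 'cV[R]_d)
    (A : 'M[R]_d) (I : {set 'I_d}) :
  (0 < d)%N -> sym_posdef A -> reflection_Mmatrix Rm -> I != finset.set0 ->
  SRBM_hits (submat I Rm) (subvec I mu) (submat I A) (@corner R #|I|) ->
  SRBM_hits Rm mu A (face I).
Proof.
move=> _ _ [Rm_diag [Rm_off _]] _ hits z z0 dO Omega P F B L Z Z_SRBM.
have fZ_SRBM := face_Z_SRBM I Rm_diag Rm_off Z_SRBM.
have z0I : orthant (subvec I z) by move=> k; rewrite mxE.
have [filtF [_ [cfZ [afZ [fZ0 _]]]]] := fZ_SRBM.
have [_ [_ [cZ [aZ [Z0 _]]]]] := Z_SRBM.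
pose fZ := face_Z I Rm B.
(* The corner is the face of all coordinates, so one measurability lemma covers both events. *)
have cornerE t w : corner (fZ t w) <-> face [set: 'I_#|I|]%SET (fZ t w).
  split=> [->|[_ H]].
    by split=> [i|i _]; rewrite mxE.
  by apply/matrixP => i j; rewrite (ord1 j) H ?inE// mxE.
(* The hypothesis holds on every filtered probability space, in particular for the reduced SRBM
   built on the given one; an inclusion of events remains. *)
apply: lt_le_trans (hits _ z0I _ _ _ _ _ _ _ fZ_SRBM) _.
rewrite (_ : [set w | _] =
    [set w | exists t, 0 < t /\ face [set: 'I_#|I|]%SET (fZ t w)]); last first.
  by apply/seteqP; split => w [t [t0 H]]; exists t; split => //; apply/cornerE.
apply: le_measure; rewrite ?inE.
- exact: measurable_hit_face cfZ afZ fZ0.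
- exact: measurable_hit_face cZ aZ Z0.
move=> w [t [t0 [_ fZt]]]; exists t; split => //; have t0' := ltW t0.
split=> [|i iI]; first exact: Z0.
apply/eqP; rewrite eq_le Z0// andbT.
rewrite -(enum_rankK_in iI iI) -[leRHS](fZt (enum_rank_in iI i)) ?inE//.
exact: (le_face_Z Rm_diag Rm_off Z_SRBM).
Qed.
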